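(* Let $m,n,s,k$ be integers such that $4\leq s\leq n$, $4\leq k\leq m$ and $ms=nk$. Let $t$ be a divisor of $2ms$. (1) If $s\equiv 0\pmod 4$ and $k\equiv 0\pmod 4$, then there exists an integer $\mathcal{H}_t(m,n;s,k)$. (2) If $s\equiv 2\pmod 4$ and $k\equiv 0\pmod 4$, then there exists an integer $\mathcal{H}_t(m,n;s,k)$ if and only if $m$ is even. (3) If $s\equiv 0\pmod 4$ and $k\equiv 2\pmod 4$, then there exists an integer $\mathcal{H}_t(m,n;s,k)$ if and only if $n$ is even. (4) Suppose that $m$ and $n$ are both even. If $s\equiv 2\pmod 4$ and $k\equiv 2\pmod 4$, then there exists an integer $\mathcal{H}_t(m,n;s,k)$.
   Context: A partially filled (p.f.) array is an array in which some cells are filled and the others are empty. Let $v=2ms+t$ where $t$ divides $2ms$, and let $J$ be the subgroup of order $t$ of the cyclic group $\mathbb{Z}_v$. A Heffter array $\mathcal{H}_t(m,n;s,k)$ over $\mathbb{Z}_v$ relative to $J$ is an $m\times n$ p.f. array with elements in $\mathbb{Z}_v$ such that: (a) each row contains exactly $s$ filled cells and each column contains exactly $k$ filled cells; (b) for every $x\in\mathbb{Z}_v\setminus J$, either $x$ or $-x$ appears in the array; (c) the elements in every row and every column sum to $0$ in $\mathbb{Z}_v$. Such an array is called integer if condition (c) is strengthened so that the elements of every row and every column, viewed as integers in $\pm\{1,\ldots,\lfloor v/2\rfloor\}$, sum to $0$ in $\mathbb{Z}$. *)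

(* Defs.v *)
From HB Require Import structures.
From mathcomp Require Export all_boot all_order all_algebra all_fingroup.

(* [None] is an empty cell. *)
Definition pf_array (T : Type) (m n : nat) := 'M[option T]_(m, n).

(* The order v = 2ms + t of the ambient cyclic group. The type 'Z_v is the ring
   of integers mod v only when v > 1. *)
Definition heffter_order (t m s : nat) : nat := 2 * m * s + t.

Definition row_col_filled {T : Type} {m n : nat} (s k : nat)
    (A : pf_array T m n) : Prop :=
  (forall i : 'I_m, #|[set j : 'I_n | isSome (A i j)]| = s) /\
  (forall j : 'I_n, #|[set i : 'I_m | isSome (A i j)]| = k).

Definition appears {T : Type} {m n : nat} (A : pf_array T m n) (x : T) : Prop :=
  exists i j, A i j = Some x.

Definition covers_outside {v m n : nat} (J : {set 'Z_v})
    (A : pf_array 'Z_v m n) : Prop :=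
  forall x : 'Z_v, x \notin J -> appears A x \/ appears A (- x)%R.

(* Empty cells are sent to 0, so they do not contribute to the sums. *)
Definition zero_sums {T : Type} {V : zmodType} {m n : nat} (f : T -> V)
    (A : pf_array T m n) : Prop :=
  (forall i : 'I_m, \sum_(j < n) oapp f 0 (A i j) = 0)%R /\
  (forall j : 'I_n, \sum_(i < m) oapp f 0 (A i j) = 0)%R.

(* The group law of {group 'Z_v} is addition mod v; as 'Z_v is cyclic, J is its
   unique subgroup of order t. *)
Definition heffter (t m n s k : nat)
    (A : pf_array 'Z_(heffter_order t m s) m n) : Prop :=
  exists J : {group 'Z_(heffter_order t m s)},
    [/\ #|J| = t, row_col_filled s k A, covers_outside J A & zero_sums id A].

(* The representative of x in {- floor (v/2), ..., floor (v/2)}. When t divides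
   2ms, the residues 0 and, for v even, v/2 lie in J (t is even when v is), and
   the ms filled cells of a Heffter array are just enough to cover the ms pairs
   {x, -x} outside J; hence neither residue occurs in it, and this is the only
   representative of an entry in +-{1, ..., floor (v/2)}. *)
Definition signed_rep {v : nat} (x : 'Z_v) : int :=
  (if (x <= v %/ 2)%N then x%:Z else x%:Z - v%:Z)%R.

Definition integer_heffter (t m n s k : nat)
    (A : pf_array 'Z_(heffter_order t m s) m n) : Prop :=
  heffter t m n s k A /\ zero_sums signed_rep A.

Definition exists_integer_heffter (t m n s k : nat) : Prop :=
  exists A : pf_array 'Z_(heffter_order t m s) m n,
    integer_heffter t m n s k A.

(* Main.v *)
(** A Heffter array of this kind is a zero-sum partially filled integer array
    whose absolute values are the numbers [0 < u < v/2] not divisible by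
    [L = v/t].  Up to signs this set splits into [N = ms/4] four-term arithmetic
    progressions ("chunks") [x, x+al, x+2al, x+3al] with a common difference
    [al], equal to [1] or to [L].  A chunk placed with alternating signs in a
    2x2 block has row and column sums that are small multiples of [al],
    independent of [x], so only the arrangement of block types matters.

    With [d = gcd m n] and [c = gcd s k] the filled cells are taken on [c] cyclic
    diagonals of [d x d] cells.  If one of [s], [k] is divisible by [4] the
    defects of the blocks cancel along the diagonals.  If [s] and [k] are both
    [2] mod [4], a square core is cut off, and the rest is covered by the
    previous case.  In the core, rows alternate between the block patterns
    [U B W] and [A A B].  This closes up cyclically when the core has an even
    number of block rows (that is, [N] is even); when it is odd, a parity
    obstruction forces one column of blocks to be replaced by a special 6x2
    "patch" of twelve numbers of the set, whose shape depends on [t]. *)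

Require Import Defs.
From mathcomp Require Import all_solvable.
From mathcomp Require Import zify ring.
Import GRing.Theory Num.Theory.

Set Implicit Arguments.
Unset Strict Implicit.
Unset Printing Implicit Defensive.

(** * Zero-sum arrays and their assembly *)

Section Arrays.
Local Open Scope ring_scope.

(** The filled cells are counted by an integer sum, so that the zero sum and the count both have the
    form [\sum_j oapp F 0 (f j)] and follow from one identity in [F]. *)
Definition line_ok (J : finType) (s : nat) (f : J -> option int) : Prop :=
  \sum_j oapp id 0 (f j) = 0 /\ \sum_j oapp (fun=> 1) 0 (f j) = s%:Z.

Definition zero_sum_array (m n s k : nat) (V : nat -> Prop) : Prop :=
  exists M : 'I_m -> 'I_n -> option int,
    [/\ forall i, line_ok s (M i), forall j, line_ok k (M^~ j),
        forall i j v, M i j = Some v -> V `|v|%N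
      & forall u, V u -> exists i j v, M i j = Some v /\ u = `|v|%N].

Lemma zero_sum_array_ext m n s k V V' :
  (forall u, V u <-> V' u) ->
  zero_sum_array m n s k V -> zero_sum_array m n s k V'.
Proof.
move=> eqV [M [Hr Hc H1 H2]]; exists M; split=> // [i j v /H1 /eqV //|u /eqV/H2 //].
Qed.

Lemma zero_sum_array_tr m n s k V :
  zero_sum_array m n s k V -> zero_sum_array n m k s V.
Proof.
move=> [M [Hr Hc H1 H2]]; exists (fun i j => M j i); split=> //.
- by move=> i j v; apply: H1.
- by move=> u /H2 [i [j [v H]]]; exists j, i, v.
Qed.

Lemma sum_enum_val (J : finType) (F : J -> int) :
  \sum_(j < #|J|) F (enum_val j) = \sum_j F j.
Proof. by rewrite [RHS](reindex _ (onW_bij _ (@enum_val_bij J))). Qed.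

Lemma zero_sum_array_fin (I J : finType) s k V (M : I -> J -> option int) :
  (forall i, line_ok s (M i)) -> (forall j, line_ok k (M^~ j)) ->
  (forall i j v, M i j = Some v -> V `|v|%N) ->
  (forall u, V u -> exists i j v, M i j = Some v /\ u = `|v|%N) ->
  zero_sum_array #|I| #|J| s k V.
Proof.
move=> Hr Hc H1 H2; exists (fun i j => M (enum_val i) (enum_val j)); split.
- by move=> i; have [E1 E2] := Hr (enum_val i); split;
    [rewrite -[RHS]E1|rewrite -[RHS]E2]; rewrite -[RHS]sum_enum_val.
- by move=> j; have [E1 E2] := Hc (enum_val j); split;
    [rewrite -[RHS]E1|rewrite -[RHS]E2]; rewrite -[RHS]sum_enum_val.
- by move=> i j v; apply: H1.
- move=> u /H2 [i [j [v H]]]; exists (enum_rank i), (enum_rank j), v.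
  by rewrite !enum_rankK.
Qed.

Lemma zero_sum_array_catr m n1 n2 s1 s2 k V1 V2 :
  zero_sum_array m n1 s1 k V1 -> zero_sum_array m n2 s2 k V2 ->
  zero_sum_array m (n1 + n2)%N (s1 + s2)%N k (fun u => V1 u \/ V2 u).
Proof.
move=> [M [Mr Mc M1 M2]] [N [Nr Nc N1 N2]].
exists (fun i j => match split j with inl j => M i j | inr j => N i j end).
have sL (j : 'I_n1) : split (lshift n2 j) = inl j := unsplitK (inl j).
have sR (j : 'I_n2) : split (rshift n1 j) = inr j := unsplitK (inr j).
split.
- move=> i.
  have line (F : int -> int) : \sum_j oapp F 0 (match split j with inl j => M i j | inr j => N i j end)
      = \sum_j oapp F 0 (M i j) + \sum_j oapp F 0 (N i j).
    rewrite big_split_ord /=; congr (_ + _); apply: eq_bigr => j _.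
      by rewrite sL.
    by rewrite sR.
  have [M0 Ms] := Mr i; have [N0 Ns] := Nr i.
  by split; rewrite line ?M0 ?N0 ?Ms ?Ns ?addr0 ?PoszD.
- by move=> j; case: (split j) => j'; [apply: Mc|apply: Nc].
- move=> i j v; case: (split j) => j' Hv; [left; exact: M1 Hv|right; exact: N1 Hv].
- move=> u [/M2|/N2] [i [j [v H]]].
    by exists i, (lshift n2 j), v; rewrite sL.
  by exists i, (rshift n1 j), v; rewrite sR.
Qed.

Section Assembly.
Variables (P I J : finType) (rw : P -> I) (cl : P -> J) (E : P -> int).
Hypothesis rc_inj : forall p p', rw p = rw p' -> cl p = cl p' -> p = p'.

Let M i j := omap E [pick p | (rw p == i) && (cl p == j)].

Let cellE (F : int -> int) i j :
  oapp F 0 (M i j) = \sum_(p | (rw p == i) && (cl p == j)) F (E p).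
Proof.
rewrite /M; case: pickP => [p /andP[/eqP <- /eqP <-]|no]; last by rewrite big_pred0.
rewrite (big_pred1 p) // => q; apply/andP/eqP => [[/eqP e1 /eqP e2]|-> //].
exact: rc_inj.
Qed.

(** [P] indexes the filled cells. A row and a column determine at most one of them, so the [pick] in
    [M] is unambiguous and each line sum of [M] is a sum over the cells of that line. *)
Lemma zero_sum_array_assemble s k :
  (forall i, \sum_(p | rw p == i) E p = 0) ->
  (forall j, \sum_(p | cl p == j) E p = 0) ->
  (forall i, \sum_(p | rw p == i) 1 = s%:Z) ->
  (forall j, \sum_(p | cl p == j) 1 = k%:Z) ->
  zero_sum_array #|I| #|J| s k (fun u => exists p, u = `|E p|%N).
Proof.
move=> r0 c0 rs ck; apply: (@zero_sum_array_fin I J s k _ M).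
- move=> i; have line (F : int -> int) : \sum_j oapp F 0 (M i j) = \sum_(p | rw p == i) F (E p).
    rewrite (partition_big cl predT) //=.
    by apply: eq_bigr => j _; rewrite cellE.
  by split; rewrite line.
- move=> j; have line (F : int -> int) : \sum_i oapp F 0 (M i j) = \sum_(p | cl p == j) F (E p).
    rewrite (partition_big rw predT) //=.
    by apply: eq_bigr => i _; rewrite cellE; apply: eq_bigl => p; rewrite andbC.
  by split; rewrite line.
- by move=> i j v; rewrite /M; case: pickP => //= p _ [<-]; exists p.
- move=> u [p ->]; exists (rw p), (cl p), (E p); split=> //; rewrite /M.
  case: pickP => [q /andP[/eqP e1 /eqP e2]|/(_ p)]; last by rewrite !eqxx.
  by rewrite /= (rc_inj e1 e2).
Qed.

End Assembly.

Section Cyclic.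
Variables (d : nat) (Q I J : finType).
Variables (rho gam : Q -> bool -> 'I_d.+1) (ri : Q -> bool -> I) (cj : Q -> bool -> J).
Variable E : 'I_d.+1 -> Q -> bool -> bool -> int.
Hypothesis offset_inj : forall q a b q' a' b',
  gam q b - rho q a = gam q' b' - rho q' a' -> ri q a = ri q' a' ->
  cj q b = cj q' b' -> [/\ q = q', a = a' & b = b'].

Let P := ('I_d.+1 * Q * bool * bool)%type.

Let sum4 (f : P -> int) :
  \sum_p f p = \sum_q \sum_a \sum_b \sum_x f (x, q, a, b).
Proof.
have pairE (A B : finType) (g : A * B -> int) :
    \sum_p g p = \sum_a \sum_b g (a, b).
  by rewrite pair_bigA; apply: eq_bigr => -[].
rewrite !pairE.
rewrite exchange_big; apply: eq_bigr => q _.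
rewrite exchange_big; apply: eq_bigr => a _.
by rewrite exchange_big.
Qed.

Let sum_shift (x0 c : 'I_d.+1) (f : 'I_d.+1 -> int) (t : bool) :
  \sum_x (if (x + c == x0) && t then f x else 0) = if t then f (x0 - c) else 0.
Proof.
case: t; last by rewrite big1 // => x _; rewrite andbF.
rewrite -big_mkcond (big_pred1 (x0 - c)) // => x /=.
by rewrite andbT eq_sym -subr_eq eq_sym.
Qed.

(** [q] names a family of blocks, [x] the position of a block in the family, [a] and [b] the row and
    column inside the block. The difference of the cyclic coordinates of column and row is
    independent of [x]; as it determines [q], [a], [b] once the classes [ri], [cj] are known, no two
    entries share a cell. A pair [q], [a] puts two entries into a row, whence the summand [2]. *)
Lemma zero_sum_array_cyclic s k :
  (forall x i, \sum_q \sum_(a | ri q a == i) \sum_b E (x - rho q a) q a b = 0) ->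
  (forall x j, \sum_q \sum_(b | cj q b == j) \sum_a E (x - gam q b) q a b = 0) ->
  (forall i, \sum_q \sum_(a | ri q a == i) 2 = s%:Z) ->
  (forall j, \sum_q \sum_(b | cj q b == j) 2 = k%:Z) ->
  zero_sum_array (d.+1 * #|I|)%N (d.+1 * #|J|)%N s k
    (fun u => exists x q a b, u = `|E x q a b|%N).
Proof.
move=> r0 c0 rs ck.
pose rw (p : P) : 'I_d.+1 * I := let: (x, q, a, b) := p in (x + rho q a, ri q a).
pose cl (p : P) : 'I_d.+1 * J := let: (x, q, a, b) := p in (x + gam q b, cj q b).
pose E' (p : P) := let: (x, q, a, b) := p in E x q a b.
have rc_inj p p' : rw p = rw p' -> cl p = cl p' -> p = p'.
  case: p p' => [[[x q] a] b] [[[x' q'] a'] b'] /= h h'.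
  have /= e1 := congr1 fst h; have /= e2 := congr1 snd h.
  have /= e3 := congr1 fst h'; have /= e4 := congr1 snd h'.
  have e : gam q b - rho q a = gam q' b' - rho q' a'.
    by rewrite -(addrKA x) [_ + x]addrC e3 e1 [x' + gam _ _]addrC addrKA.
  have [? ? ?] := offset_inj e e2 e4; subst q' a' b'.
  by rewrite (addIr _ e1).
have rowS (F : int -> int) x i : \sum_(p | rw p == (x, i)) F (E' p) =
    \sum_q \sum_(a | ri q a == i) \sum_b F (E (x - rho q a) q a b).
  rewrite big_mkcond sum4; apply: eq_bigr => q _.
  rewrite [RHS]big_mkcond; apply: eq_bigr => a _.
  under eq_bigr => b _ do
    rewrite /= /eq_op /= (sum_shift _ _ (fun x => F (E x q a b))).
  by case: ifP => // _; rewrite big1.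
have colS (F : int -> int) x j : \sum_(p | cl p == (x, j)) F (E' p) =
    \sum_q \sum_(b | cj q b == j) \sum_a F (E (x - gam q b) q a b).
  rewrite big_mkcond sum4; apply: eq_bigr => q _.
  rewrite [RHS]big_mkcond exchange_big; apply: eq_bigr => b _.
  under eq_bigr => a _ do
    rewrite /= /eq_op /= (sum_shift _ _ (fun x => F (E x q a b))).
  by case: ifP => // _; rewrite big1.
have <- : #|{: 'I_d.+1 * I}| = (d.+1 * #|I|)%N by rewrite card_prod card_ord.
have <- : #|{: 'I_d.+1 * J}| = (d.+1 * #|J|)%N by rewrite card_prod card_ord.
have H1 (i : ('I_d.+1 * I)%type) : \sum_(p | rw p == i) E' p = 0.
  by case: i => x i; rewrite (rowS id) r0.
have H2 (j : ('I_d.+1 * J)%type) : \sum_(p | cl p == j) E' p = 0.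
  by case: j => x j; rewrite (colS id) c0.
have H3 (i : ('I_d.+1 * I)%type) : \sum_(p | rw p == i) 1 = s%:Z.
  case: i => x i; rewrite (rowS (fun=> 1)) -(rs i).
  by do 2!apply: eq_bigr => ? _; rewrite big_const card_bool.
have H4 (j : ('I_d.+1 * J)%type) : \sum_(p | cl p == j) 1 = k%:Z.
  case: j => x j; rewrite (colS (fun=> 1)) -(ck j).
  by do 2!apply: eq_bigr => ? _; rewrite big_const card_bool.
apply: zero_sum_array_ext (zero_sum_array_assemble rc_inj H1 H2 H3 H4) => u; split.
  by case=> -[[[x q] a] b] ->; exists x, q, a, b.
by case=> x [q [a [b ->]]]; exists (x, q, a, b).
Qed.

End Cyclic.
End Arrays.

(** * Blocks and chunks *)

Section Blocks.
Local Open Scope ring_scope.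

(** First terms are integers because some progressions will start below zero; only absolute values
    are recorded. *)
Definition chunks (al : int) (xs : seq int) (u : nat) : Prop :=
  exists2 x, x \in xs & exists r : nat, (r < 4)%N /\ u = `|(x + al * r%:Z)%R|%N.

Lemma chunks_cat al xs ys u :
  chunks al (xs ++ ys) u <-> chunks al xs u \/ chunks al ys u.
Proof.
split=> [[x]|[] [x xin H]].
- by rewrite mem_cat => /orP[] xin H; [left|right]; exists x.
- by exists x; rewrite // mem_cat xin.
- by exists x; rewrite // mem_cat xin orbT.
Qed.

Lemma eq_mem_chunks al xs ys u : xs =i ys -> chunks al xs u <-> chunks al ys u.
Proof. by move=> e; split=> -[x xin H]; exists x; rewrite ?e // -e. Qed.

(* Shapes of a 2x2 block filled with a chunk: entry [(a, b)] carries the term of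
   index [block_pos l a b] with sign [(-1)^(a+b)]; for instance [TU] is
   [[x+3al, -x], [-(x+2al), x+al]]. *)
Variant block_type := TA | TA' | TA'' | TB | TU | TW.

Definition block_pos (l : block_type) (a b : bool) : nat :=
  let pick p00 p01 p10 p11 :=
    if a then (if b then p11 else p10) else if b then p01 else p00 in
  match l with
  | TA => pick 3 2 1 0
  | TA' => pick 2 3 0 1
  | TA'' => pick 0 1 2 3
  | TB => pick 0 2 1 3
  | TU => pick 3 0 2 1
  | TW => pick 0 1 3 2
  end%N.

Definition block (al x : int) (l : block_type) (a b : bool) : int :=
  (-1) ^+ (a (+) b) * (x + al * (block_pos l a b)%:Z).

(** Row sum of a block in units of [al]: the two entries of a row have opposite signs, so [x]
    cancels. *)
Definition row_defect (l : block_type) (a : bool) : int :=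
  match l with
  | TA => if a then -1 else 1
  | TA' | TA'' => if a then 1 else -1
  | TB => if a then 2 else -2
  | TU => if a then -1 else 3
  | TW => -1
  end.

Definition col_defect (l : block_type) (b : bool) : int :=
  match l with
  | TA | TA' => if b then -2 else 2
  | TA'' => if b then 2 else -2
  | TB => if b then 1 else -1
  | TU => 1
  | TW => if b then 1 else -3
  end.

Lemma row_blockE al x l a : \sum_b block al x l a b = al * row_defect l a.
Proof. by rewrite big_bool /block; case: l; case: a => /=; ring. Qed.

Lemma col_blockE al x l b : \sum_a block al x l a b = al * col_defect l b.
Proof. by rewrite big_bool /block; case: l; case: b => /=; ring. Qed.

Lemma block_pos_lt l a b : (block_pos l a b < 4)%N.
Proof. by case: l; case: a; case: b. Qed.

Lemma block_pos_onto l r : (r < 4)%N -> exists a b, block_pos l a b = r.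
Proof.
move=> r_lt; have : [|| block_pos l false false == r, block_pos l false true == r,
    block_pos l true false == r | block_pos l true true == r].
  by case: l; case: r r_lt => [|[|[|[|]]]].
by case/or4P => /eqP; eauto.
Qed.

Lemma absz_block al x l a b :
  `|block al x l a b|%N = `|(x + al * (block_pos l a b)%:Z)%R|%N.
Proof. by rewrite /block; case: (a (+) b); rewrite ?expr1 ?expr0 ?mulN1r ?abszN ?mul1r. Qed.

Section Values.
Variables (K : finType) (G : pred K) (al : int) (xs : seq int).
Variables (lab : K -> block_type) (pt : K -> bool -> bool -> int).

(** [G] marks the blocks filled with chunks, which are dealt out in the order of [enum G]; the other
    blocks belong to a patch. *)
Definition block_entry (k : K) (a b : bool) : int :=
  if G k then block al (nth 0 xs (index k (enum G))) (lab k) a b else pt k a b.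

Lemma block_values u : size xs = #|G| ->
  (exists k a b, u = `|block_entry k a b|%N) <->
  chunks al xs u \/ exists k a b, ~~ G k /\ u = `|pt k a b|%N.
Proof.
move=> sz; split.
  case=> k [a [b ->]]; rewrite /block_entry.
  case: ifPn => Gk; last by right; exists k, a, b.
  left; rewrite absz_block; exists (nth 0 xs (index k (enum G))).
    by rewrite mem_nth // sz cardE index_mem mem_enum.
  by exists (block_pos (lab k) a b); rewrite block_pos_lt.
case=> [[x xin [r [rlt ->]]]|[k [a [b [nGk ->]]]]].
  have ilt : (index x xs < size (enum G))%N by rewrite -cardE -sz index_mem.
  have [k0 _] : exists k0 : K, true by case: (enum G) ilt => // k0; exists k0.
  pose k := nth k0 (enum G) (index x xs).
  have Gk : G k by rewrite -[G k]/(k \in G) -mem_enum mem_nth.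
  have [a [b pr]] := block_pos_onto (lab k) rlt.
  exists k, a, b; rewrite /block_entry Gk absz_block pr.
  by rewrite index_uniq ?enum_uniq // nth_index.
by exists k, a, b; rewrite /block_entry (negPf nGk).
Qed.

End Values.

(** Since every list of [N] chunks is allowed, arrays can be glued by cutting a given list at any
    place. *)
Definition formal_array (m n s k N : nat) : Prop :=
  forall (al : int) (xs : seq int), size xs = N -> zero_sum_array m n s k (chunks al xs).

Lemma formal_array_tr m n s k N : formal_array m n s k N -> formal_array n m k s N.
Proof. by move=> H al xs /(H al); apply: zero_sum_array_tr. Qed.

Lemma formal_array_catr m n1 n2 s1 s2 k N1 N2 :
  formal_array m n1 s1 k N1 -> formal_array m n2 s2 k N2 ->
  formal_array m (n1 + n2) (s1 + s2) k (N1 + N2).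
Proof.
move=> H1 H2 al xs sz.
have e1 : size (take N1 xs) = N1 by rewrite size_take_min; lia.
have e2 : size (drop N1 xs) = N2 by rewrite size_drop; lia.
apply: zero_sum_array_ext (zero_sum_array_catr (H1 al _ e1) (H2 al _ e2)) => u.
by rewrite -chunks_cat cat_take_drop.
Qed.

Lemma formal_array_nocol m k : formal_array m 0 0 k 0.
Proof.
move=> al xs /size0nil ->; exists (fun _ _ => None); split=> //.
- by move=> i; split; rewrite big_ord0.
- by case.
- by move=> u [].
Qed.

Lemma formal_array_mulr m n s k N q :
  formal_array m n s k N -> formal_array m (n * q)%N (s * q)%N k (N * q)%N.
Proof.
move=> H; elim: q => [|q IH]; last by rewrite !mulnS; apply: formal_array_catr.
by rewrite !muln0; apply: formal_array_nocol.
Qed.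

Lemma formal_array_mull m n s k N q :
  formal_array m n s k N -> formal_array (m * q)%N n s (k * q)%N (N * q)%N.
Proof. by move=> H; apply/formal_array_tr/formal_array_mulr/formal_array_tr. Qed.

Lemma inZpB d x y : (y <= x)%N -> inZp x - inZp y = inZp (x - y) :> 'I_d.+1.
Proof.
move=> le_yx; apply/eqP; rewrite subr_eq; apply/eqP/val_inj => /=.
by rewrite modnDm subnK.
Qed.

Lemma inZp_inj_small d x y :
  (x < d.+1)%N -> (y < d.+1)%N -> inZp x = inZp y :> 'I_d.+1 -> x = y.
Proof. by move=> hx hy /(congr1 val) /=; rewrite !modn_small. Qed.

Section CyclicBlocks.
Variables (d : nat) (Q I J : finType).
Variables (rho gam : Q -> bool -> 'I_d.+1) (ri : Q -> bool -> I) (cj : Q -> bool -> J).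
Variable lab : Q -> block_type.

(** Block sums are [al] times a defect, whatever chunk fills the block, so only sums of defects have
    to vanish. *)
Lemma formal_array_cyclic s k :
  (forall q a b q' a' b',
    gam q b - rho q a = gam q' b' - rho q' a' -> ri q a = ri q' a' ->
    cj q b = cj q' b' -> [/\ q = q', a = a' & b = b']) ->
  (forall i, \sum_q \sum_(a | ri q a == i) row_defect (lab q) a = 0) ->
  (forall j, \sum_q \sum_(b | cj q b == j) col_defect (lab q) b = 0) ->
  (forall i, \sum_q \sum_(a | ri q a == i) 2 = s%:Z) ->
  (forall j, \sum_q \sum_(b | cj q b == j) 2 = k%:Z) ->
  formal_array (d.+1 * #|I|) (d.+1 * #|J|) s k (d.+1 * #|Q|).
Proof.
move=> inj r0 c0 rs ck al xs sz.
pose K := ('I_d.+1 * Q)%type.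
pose E x q := block_entry predT al xs (fun k : K => lab k.2) (fun _ _ _ => 0) (x, q).
have EE x q a b : E x q a b = block al (nth 0 xs (index (x, q) (enum predT))) (lab q) a b.
  by [].
have szK : size xs = #|{: K}| by rewrite sz card_prod card_ord.
have R x i : \sum_q \sum_(a | ri q a == i) \sum_b E (x - rho q a) q a b = 0.
  transitivity (al * \sum_q \sum_(a | ri q a == i) row_defect (lab q) a).
    rewrite big_distrr; apply: eq_bigr => q _.
    by rewrite big_distrr; apply: eq_bigr => a _; under eq_bigr do rewrite EE; rewrite row_blockE.
  by rewrite r0 mulr0.
have C x j : \sum_q \sum_(b | cj q b == j) \sum_a E (x - gam q b) q a b = 0.
  transitivity (al * \sum_q \sum_(b | cj q b == j) col_defect (lab q) b).
    rewrite big_distrr; apply: eq_bigr => q _.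
    by rewrite big_distrr; apply: eq_bigr => b _; under eq_bigr do rewrite EE; rewrite col_blockE.
  by rewrite c0 mulr0.
apply: zero_sum_array_ext (zero_sum_array_cyclic inj R C rs ck) => u.
have [V1 V2] := @block_values K predT al xs (fun k => lab k.2) (fun _ _ _ => 0) u szK.
split=> [[x [q [a [b H]]]]|H].
  by case: V1 => // [|[? [? [? []]]] //]; exists (x, q), a, b.
by case: V2 => [|[x q] [a [b H']]]; [left|exists x, q, a, b].
Qed.

End CyclicBlocks.

(** A block takes the rows [x], [x+2] and two adjacent columns, so its four cells lie one each on
    the diagonals [4q, ..., 4q+3]; the summand [2] in the column offset keeps these differences
    nonnegative. For each [q], a row meets both rows of a [TA''] block and a column both columns,
    and their defects are opposite. *)
Lemma formal_array_circulant d g :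
  (4 * g <= d)%N -> formal_array d d (4 * g) (4 * g) (d * g).
Proof.
case: d => [|d] le_gd.
  have -> : g = 0%N by lia.
  rewrite muln0 => al xs /size0nil ->; exists (fun _ _ => None).
  by split=> // [[]|[]|u []].
have := @formal_array_cyclic d 'I_g unit unit (fun _ a => inZp (2 * a))
  (fun q b => inZp (4 * q + 2 + b)) (fun _ _ => tt) (fun _ _ => tt) (fun=> TA'')
  (4 * g) (4 * g).
rewrite card_unit card_ord muln1; apply.
- move=> q a b q' a' b'; rewrite !inZpB; [|by case: (a'); lia|by case: (a); lia].
  have lt_q := ltn_ord q; have lt_q' := ltn_ord q'.
  move/inZp_inj_small => e _ _; have {}e : (4 * q + 2 + b - 2 * a = 4 * q' + 2 + b' - 2 * a')%N.
    by apply: e; [case: (a); case: (b); lia|case: (a'); case: (b'); lia].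
  have eq : q = q' by apply: val_inj => /=; move: e; case: (a); case: (b); case: (a'); case: (b'); lia.
  by subst q'; move: e; case: (a); case: (b); case: (a'); case: (b') => //; lia.
- by move=> i; rewrite big1 // => q _; rewrite big_bool; case: i.
- by move=> i; rewrite big1 // => q _; rewrite big_bool; case: i.
- by move=> i; rewrite (eq_bigr (fun=> 4)) => [|q _]; case: i;
    rewrite ?big_bool // sumr_const card_ord; lia.
- by move=> i; rewrite (eq_bigr (fun=> 4)) => [|q _]; case: i;
    rewrite ?big_bool // sumr_const card_ord; lia.
Qed.

End Blocks.

(** * Arrays in which one line size is divisible by 4 *)

Section Paired.
Local Open Scope ring_scope.

(* The row defects [-2, 1, 1, -1, 1, -1, 1, ...] of these types cancel. *)
Definition paired_type (i : nat) : block_type :=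
  if i is i'.+3 then (if odd i' then TA else TA') else if i is 0 then TB else TA.

Lemma paired_row_sum r a : \sum_(i < r.*2.+3) row_defect (paired_type i) a = 0.
Proof.
elim: r => [|r IH]; first by rewrite !big_ord_recl big_ord0; case: a.
rewrite doubleS 2!big_ord_recr /= IH add0r odd_double /=.
by case: a {IH}.
Qed.

Lemma paired_col_sum i : \sum_b col_defect (paired_type i) b = 0.
Proof. by rewrite big_bool; case: i => [|[|[|i]]] //=; case: odd. Qed.

(** The two rows of a block lie in different row classes, its two columns are neighbours in one
    column class. So a column meets both columns of each type, whose defects cancel, and a row meets
    one row of every type, which cancel over the whole list. *)
Lemma formal_array_paired d r (J : finType) (o : 'I_r.*2.+3 -> nat)
    (jj : 'I_r.*2.+3 -> J) k :
  (forall i, (o i).+1 < d)%N ->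
  (forall i i' (b b' : bool), (o i + b = o i' + b')%N -> jj i = jj i' -> i = i' /\ b = b') ->
  (forall j, \sum_(i | jj i == j) 4 = k%:Z) ->
  formal_array (d * 2) (d * #|J|) (r.*2.+3).*2 k (d * r.*2.+3).
Proof.
case: d => [|d] lt_o inj ck; first by have := lt_o ord0.
have := @formal_array_cyclic d 'I_r.*2.+3 bool J (fun _ _ => 0)
  (fun i b => inZp (o i + b)) (fun _ a => a) (fun i _ => jj i) (paired_type \o val)
  (r.*2.+3).*2 k.
rewrite card_bool card_ord; apply.
- move=> i a b i' a' b'; rewrite !subr0 => /inZp_inj_small e -> /inj.
  have lt_i := lt_o i; have lt_i' := lt_o i'.
  by case/(_ _ _ (e _ _)) => [| |-> ->] //; [case: (b)|case: (b')]; lia.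
- move=> a; rewrite -[RHS](paired_row_sum r a); apply: eq_bigr => i _.
  by rewrite big_pred1_eq.
- move=> j; rewrite big1 // => i _; case: eqP => _.
    by rewrite paired_col_sum.
  by rewrite big_pred0.
- move=> a; rewrite (eq_bigr (fun=> 2)) => [|i _]; last by rewrite big_pred1_eq.
  by rewrite sumr_const card_ord; lia.
- move=> j; rewrite -[RHS](ck j) [RHS]big_mkcond; apply: eq_bigr => i _.
  by case: eqP => _; rewrite ?big_bool ?big_pred0.
Qed.

End Paired.

(** With a single column class the blocks are separated by using the disjoint diagonal pairs [2i],
    [2i+1]. *)
Lemma formal_array_tall d r :
  r.*2.+3.*2 <= d ->
  formal_array (d * 2) d r.*2.+3.*2 r.*2.+3.*2.*2 (d * r.*2.+3).
Proof.
move=> le_rd.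
have := @formal_array_paired d r unit (fun i => i.*2) (fun=> tt) r.*2.+3.*2.*2.
rewrite card_unit muln1; apply.
- by move=> i /=; have := ltn_ord i; lia.
- move=> i i' b b' /= e _.
  have ei : i = i' by apply: val_inj => /=; move: e; case: b; case: b'; lia.
  by subst i'; split=> //; move: e; case: b; case: b' => //; lia.
- by case; rewrite sumr_const card_ord; lia.
Qed.

(** Three blocks with equal offsets are kept apart by three column classes. This serves [c = 2],
    where a square alone has too few diagonals for the row defects [-2, 1, 1]. *)
Lemma formal_array_three d : 1 < d -> formal_array (d * 2) (d * 3) 6 4 (d * 3).
Proof.
move=> lt_d; have := @formal_array_paired d 0 'I_3 (fun=> 0) id 4.
rewrite card_ord; apply=> //.
- by move=> i i' b b' /= e ->; split=> //; move: e; case: b; case: b'.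
- by move=> j; rewrite big_pred1_eq.
Qed.

(** The array is cut into [m' * n'] squares of side [d], each to receive [c] filled cells per
    line. *)
Lemma gcd_parametrization m n s k :
  0 < s -> 0 < k -> s <= n -> m * s = n * k ->
  exists d c m' n', [/\ m = d * m', n = d * n', s = c * n', k = c * m' & c <= d]
    /\ coprime m' n'.
Proof.
move=> s0 k0 sn e.
have n0 : 0 < n by lia.
have m0 : 0 < m by nia.
have d0 : 0 < gcdn m n by rewrite gcdn_gt0 m0.
have [m' em] : exists m', m = gcdn m n * m'.
  by exists (m %/ gcdn m n); rewrite mulnC divnK // dvdn_gcdl.
have [n' en] : exists n', n = gcdn m n * n'.
  by exists (n %/ gcdn m n); rewrite mulnC divnK // dvdn_gcdr.
have cop : coprime m' n'.
  have : gcdn m n * gcdn m' n' == gcdn m n * 1.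
    by rewrite muln_gcdr -em -en muln1.
  by rewrite eqn_pmul2l.
have e' : m' * s = n' * k.
  by apply/eqP; rewrite -(eqn_pmul2l d0) !mulnA -em -en e.
have /dvdnP[c es] : n' %| s.
  by rewrite -(@Gauss_dvdr n' m') ?e' ?dvdn_mulr // coprime_sym.
have n'0 : 0 < n' by lia.
exists (gcdn m n), c, m', n'; split=> //; split=> //.
  by apply/eqP; rewrite -(eqn_pmul2l n'0) -e' es; apply/eqP; lia.
by rewrite -(leq_pmul2r n'0) -es -en.
Qed.

Lemma formal_array00 m n s k N :
  0 < s -> 0 < k -> s <= n -> m * s = n * k -> 4 %| s -> 4 %| k -> 4 * N = m * s ->
  formal_array m n s k N.
Proof.
move=> s0 k0 sn e s4 k4 eN.
have [d [c [m' [n' [[em en es ek le_cd] cop]]]]] := gcd_parametrization s0 k0 sn e.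
(* As [m'] and [n'] are coprime, [c] is the gcd of [s] and [k]. *)
have /dvdnP[g ec] : 4 %| c.
  have : 4 %| gcdn s k by rewrite dvdn_gcd s4.
  by rewrite es ek -muln_gcdr gcdnC (eqP cop) muln1.
have le_gd : 4 * g <= d by lia.
have := formal_array_mull (q := m') (formal_array_mulr (q := n') (formal_array_circulant le_gd)).
have -> : d * g * n' * m' = N by nia.
by rewrite -em -en [4 * g]mulnC -ec -es -ek.
Qed.

Lemma formal_array20 m n s k N :
  4 <= s -> 0 < k -> s <= n -> m * s = n * k -> s %% 4 = 2 -> 4 %| k -> 4 * N = m * s ->
  formal_array m n s k N.
Proof.
move=> s4 k0 sn e s2 k4 eN.
have [d [c [m' [n' [[em en es ek le_cd] cop]]]]] :=
  gcd_parametrization (leq_trans (isT : 0 < 4) s4) k0 sn e.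
have /dvdnP[c2 ec] : 2 %| c.
  have : 2 %| gcdn s k by rewrite dvdn_gcd; lia.
  by rewrite es ek -muln_gcdr gcdnC (eqP cop) muln1.
have oc2 : odd c2 by nia.
have on' : odd n' by nia.
have /dvdnP[h eh] : 2 %| m' by nia.
have [c2_ge3|c2_lt3] := leqP 3 c2.
  have [r er] : exists r, c2 = r.*2.+3 by exists ((c2 - 3) %/ 2); lia.
  have le_rd : r.*2.+3.*2 <= d by lia.
  have := formal_array_mull (q := h) (formal_array_mulr (q := n') (formal_array_tall le_rd)).
  have -> : d * r.*2.+3 * n' * h = N by nia.
  have -> : d * 2 * h = m by nia.
  have -> : r.*2.+3.*2 * n' = s by nia.
  have -> : r.*2.+3.*2.*2 * h = k by nia.
  by rewrite -en.
have e1 : c2 = 1 by lia.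
have lt_d : 1 < d by lia.
(* Now [s = 2n'] with [n'] odd, so [n'] is at least [3]. Three squares go to [formal_array_three];
   the rest are paired into squares of side [2d] with four cells per line. *)
have [q eq] : exists q, n' = 3 + q * 2 by exists ((n' - 3) %/ 2); nia.
have le_4d : 4 * 1 <= d * 2 by lia.
have := formal_array_mull (q := h) (formal_array_catr (formal_array_three lt_d)
  (formal_array_mulr (q := q) (formal_array_circulant le_4d))).
have -> : (d * 3 + d * 2 * 1 * q) * h = N by nia.
have -> : d * 2 * h = m by nia.
have -> : 6 + 4 * 1 * q = s by nia.
have -> : 4 * 1 * h = k by nia.
by have -> : d * 3 + d * 2 * q = n by nia.
Qed.

(** * The square core *)

Section Core.
Local Open Scope ring_scope.

(* Type of the block in block row [x] on the [g]-th cyclic diagonal of a core with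
   [D] block rows. *)
Definition core_type (D x g : nat) : block_type :=
  if g is g'.+3 then (if odd g' then TA'' else TA)
  else if odd x then (if g is 2 then TB else TA)
  else match g with
       | 0 => TU
       | 1 => TB
       | _ => if x.+1 == D then TB else TW
       end%N.

(* A patch occupies the three blocks of block column [0] on the diagonals [0], [1],
   [2].  Its row sums are those of blocks of types [TU], [TW], [TB], as the
   neighbouring rows expect, but its columns sum to [0], which blocks of these
   types do not achieve. *)
Definition patch_type (g : nat) : block_type :=
  match g with 0 => TU | 1 => TW | _ => TB end%N.

Definition is_patch (al : int) (P : nat -> bool -> bool -> int) : Prop :=
  (forall g a, (g < 3)%N -> \sum_b P g a b = al * row_defect (patch_type g) a) /\
  (forall b, \sum_(g < 3) \sum_a P g a b = 0).

Definition patch_values (P : nat -> bool -> bool -> int) (u : nat) : Prop :=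
  exists g a b, (g < 3)%N /\ u = `|P g a b|%N.

(** Block row [x] meets diagonal [g] in block column [x + g] mod [D], so the patch lies in the block
    rows [0], [D-1], [D-2]. *)
Definition in_patch (D x g : nat) : bool :=
  [&& odd D, (g < 3)%N & ((x + g) %% D == 0)%N].

Definition entry_type (D x g : nat) : block_type :=
  if in_patch D x g then patch_type g else core_type D x g.

(** Even rows read [U B W] and odd rows [A A B], with row defects cancelling. For odd [D] the last
    row reads [U W B], its [W] being supplied by the patch. *)
Lemma core_row3 D x a : (2 < D)%N -> (x < D)%N ->
  row_defect (entry_type D x 0) a + (row_defect (entry_type D x 1) a +
  row_defect (entry_type D x 2) a) = 0.
Proof.
move=> D3 xD; rewrite /entry_type /in_patch /=.
have -> : ((x + 0) %% D == 0)%N = (x == 0)%N by rewrite addn0 modn_small.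
have -> : ((x + 1) %% D == 0)%N = (x.+1 == D).
  have [<-|ne] := eqVneq x.+1 D; first by rewrite addn1 modnn.
  by rewrite modn_small //; lia.
have -> : ((x + 2) %% D == 0)%N = (x.+2 == D).
  have [<-|ne] := eqVneq x.+2 D; first by rewrite addn2 modnn.
  have [eD|ne1] := eqVneq x.+1 D; last by rewrite modn_small //; lia.
  rewrite -eD; have -> : (x + 2 = x.+1 + 1)%N by lia.
  by rewrite modnDl modn_small //; lia.
case: (boolP (odd D)) => oD; case: (boolP (odd x)) => ox; case: eqP => e0;
  case: eqP => e1; case: eqP => e2; case: a => //=; lia.
Qed.

(** Column [z] meets the diagonals [0], [1], [2] in rows [z], [z-1], [z-2]: the types are [U A W]
    for even [z] and [A B B] for odd [z]. For odd [D] the even rows [D-1] and [0] are cyclic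
    neighbours; the [B] ending row [D-1] rescues column [1], and column [0] is left to the patch. *)
Lemma core_col3 D z b : (2 < D)%N -> (z < D)%N -> ~~ (odd D && (z == 0)%N) ->
  col_defect (core_type D z 0) b +
  (col_defect (core_type D ((z + (D - 1)) %% D) 1) b +
   col_defect (core_type D ((z + (D - 2)) %% D) 2) b) = 0.
Proof.
move=> D3 zD.
have [->|[->|z2]] : (z = 0 \/ z = 1 \/ 2 <= z)%N by lia.
- rewrite eqxx andbT => eD; rewrite !add0n !modn_small; [|lia|lia].
  have o1 : odd (D - 1) by lia.
  have o2 : odd (D - 2) = false by lia.
  have ne : ((D - 2).+1 == D) = false by lia.
  by rewrite /core_type o1 o2 ne; case: b.
- move=> _; rewrite (_ : 1 + (D - 1) = D)%N ?modnn; last lia.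
  rewrite (_ : 1 + (D - 2) = D.-1)%N ?modn_small; [|lia|lia].
  rewrite /core_type /= prednK ?eqxx; last lia.
  by case: odd; case: b.
- move=> _; have -> : ((z + (D - 1)) %% D = z.-1)%N.
    by rewrite (_ : z + (D - 1) = z.-1 + D)%N ?modnDr ?modn_small; lia.
  have -> : ((z + (D - 2)) %% D = z.-2)%N.
    by rewrite (_ : z + (D - 2) = z.-2 + D)%N ?modnDr ?modn_small; lia.
  have o1 : odd z.-1 = ~~ odd z by lia.
  have o2 : odd z.-2 = odd z by lia.
  have ne : (z.-2.+1 == D) = false by lia.
  by rewrite /core_type o1 o2 ne; case: odd; case: b.
Qed.

Lemma sum_alternate (F : nat -> int) r :
  (forall i, F i.*2 + F i.*2.+1 = 0) -> \sum_(i < r.*2) F i = 0.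
Proof.
move=> F0; elim: r => [|r IH]; first by rewrite big_ord0.
by rewrite doubleS 2!big_ord_recr /= IH add0r F0.
Qed.

Lemma sum_ord3 (F : nat -> int) n :
  \sum_(g < n.+3) F g = F 0%N + (F 1%N + (F 2%N + \sum_(i < n) F i.+3)).
Proof. by rewrite !big_ord_recl. Qed.

Section Square.
Variables (d r : nat) (al : int) (xs : seq int) (P : nat -> bool -> bool -> int).
Let D := d.+1.
Let ka := r.*2.+3.
Hypothesis le_kaD : (ka <= D)%N.
Hypothesis size_xs : (size xs + 3 * odd D = D * ka)%N.
Hypothesis patchP : odd D -> is_patch al P.

Let K := ('I_D * 'I_ka)%type.
Let G : pred K := fun k => ~~ in_patch D k.1 k.2.
Let E (x : 'I_D) (g : 'I_ka) :=
  block_entry G al xs (fun k => core_type D k.1 k.2) (fun k => P k.2) (x, g).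

Let in_patchE (x : 'I_D) (g : nat) :
  in_patch D x g = [&& odd D, (g < 3)%N & x + inZp g == 0].
Proof.
rewrite /in_patch -val_eqE /= modnDmr.
by [].
Qed.

(** For odd [D] each of the first three diagonals meets block column [0] once, so the patch takes
    three blocks. *)
Let card_G : size xs = #|G|.
Proof.
have : (#|G| + #|[predC G]| = D * ka)%N.
  by rewrite cardC card_prod !card_ord.
suff -> : #|[predC G]| = (3 * odd D)%N by lia.
have patch_shift (g : 'I_ka) : #|[pred x : 'I_D | in_patch D x g]| = odd D && (g < 3)%N.
  have [cond|ncond] := boolP (odd D && (g < 3)%N).
    transitivity #|pred1 (- inZp g : 'I_D)|; last by rewrite card1.
    apply: eq_card => x; rewrite !inE in_patchE.
    by rewrite andbA cond addr_eq0.
  by apply: eq_card0 => x; rewrite !inE in_patchE andbA (negPf ncond).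
have -> : #|[predC G]| = (\sum_(g < ka) (odd D && (g < 3)%N))%N.
  transitivity (\sum_(g < ka) \sum_(x < D) (in_patch D x g))%N.
    rewrite exchange_big pair_bigA -sum1_card [LHS]big_mkcond; apply: eq_bigr => k _.
    by rewrite !inE /G negbK; case: in_patch.
  apply: eq_bigr => g _; rewrite -patch_shift -sum1_card [RHS]big_mkcond.
  by apply: eq_bigr => x _; rewrite inE; case: in_patch.
rewrite !big_ord_recl /= big1 => [|i _]; last by rewrite andbF.
by case: odd.
Qed.

Let row_entry x g a : \sum_b E x g a b = al * row_defect (entry_type D x g) a.
Proof.
rewrite /E /block_entry /= /G /entry_type; case: (boolP (in_patch _ _ _)) => /= pat.
  by case/and3P: pat => oD g3 _; apply: (patchP oD).1.
exact: row_blockE.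
Qed.

(** From diagonal [3] on the type does not depend on the block row, so row [0] represents all of
    them; the alternating [TA] and [TA''] have opposite defects. *)
Let tail_row a : \sum_(i < r.*2) row_defect (core_type D 0 i.+3) a = 0.
Proof.
apply: (@sum_alternate (fun i => row_defect (core_type D 0 i.+3) a)) => i.
by rewrite /= odd_double; case: a.
Qed.

Let tail_col b : \sum_(i < r.*2) col_defect (core_type D 0 i.+3) b = 0.
Proof.
apply: (@sum_alternate (fun i => col_defect (core_type D 0 i.+3) b)) => i.
by rewrite /= odd_double; case: b.
Qed.

Let row_sum (x : 'I_D) a : \sum_g \sum_b E x g a b = 0.
Proof.
under eq_bigr do rewrite row_entry.
rewrite -big_distrr /=.
rewrite (sum_ord3 (fun g => row_defect (entry_type D x g) a)).
rewrite [X in _ + (_ + (_ + X))](_ : _ = 0) ?addr0; last first.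
  rewrite -[RHS](tail_row a); apply: eq_bigr => i _.
  by rewrite /entry_type /in_patch /= andbF.
by rewrite core_row3 ?mulr0 //; move: le_kaD; rewrite /ka; lia.
Qed.

Let sub_val (z : 'I_D) g : (g <= D)%N -> val (z - inZp g) = ((z + (D - g)) %% D)%N.
Proof.
move=> gD; rewrite /= modnDmr.
have [->|ltgD] := eqVneq g D; first by rewrite modnn subn0 subnn addn0 modnDr.
by rewrite (@modn_small g) //; lia.
Qed.

Let col_sum (z : 'I_D) b : \sum_(g < ka) \sum_a E (z - inZp g) g a b = 0.
Proof.
have D3 : (2 < D)%N by move: le_kaD; rewrite /ka; lia.
have EE (x : 'I_D) (g : 'I_ka) : \sum_a E x g a b =
    if in_patch D x g then \sum_a P g a b else al * col_defect (core_type D x g) b.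
  rewrite /E /block_entry /= /G; case: (boolP (in_patch _ _ _)) => //= _.
  exact: col_blockE.
have patE (g : nat) : in_patch D ((z - inZp g)%R : 'I_D) g = [&& odd D, (g < 3)%N & (z == 0%R :> 'I_D)].
  by rewrite in_patchE subrK.
under eq_bigr do rewrite EE.
rewrite (sum_ord3 (fun g => if in_patch D ((z - inZp g)%R : 'I_D) g then \sum_a P g a b
  else al * col_defect (core_type D ((z - inZp g)%R : 'I_D) g) b)) !patE.
rewrite [X in _ + (_ + (_ + X))](_ : _ = 0) ?addr0; last first.
  transitivity (al * \sum_(i < r.*2) col_defect (core_type D 0 i.+3) b).
    rewrite big_distrr; apply: eq_bigr => i _.
    by rewrite patE andbF.
  by rewrite tail_col mulr0.
have [/andP[oD _]|ncond] := boolP (odd D && (z == 0%R :> 'I_D)).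
  by rewrite -[RHS]((patchP oD).2 b) !big_ord_recl big_ord0 addr0.
rewrite -!mulrDr !sub_val ?subn0 //; last lia.
rewrite modnDr modn_small // core_col3 ?mulr0 //.
Qed.

(** The blocks occupy [ka] cyclic diagonals of a [D] by [D] grid of blocks; the bound of [ka] by [D]
    keeps the diagonals distinct. *)
Lemma zero_sum_array_core :
  zero_sum_array (D * 2)%N (D * 2)%N ka.*2 ka.*2
    (fun u => chunks al xs u \/ (odd D /\ patch_values P u)).
Proof.
have cnt (a : bool) : \sum_(q < ka) \sum_(b | b == a) 2 = ka.*2%:Z.
  rewrite (eq_bigr (fun=> 2)) => [|q _]; last by rewrite big_pred1_eq.
  by rewrite sumr_const card_ord; lia.
have := @zero_sum_array_cyclic d 'I_ka bool bool (fun _ _ => 0) (fun g _ => inZp g)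
  (fun _ a => a) (fun _ b => b) E _ ka.*2 ka.*2 _ _ cnt cnt.
rewrite card_bool => H; apply: zero_sum_array_ext (H _ _ _) => {H}.
- move=> u; have := @block_values K G al xs (fun k => core_type D k.1 k.2) (fun k => P k.2) u card_G.
  move=> VE; split=> [[x [g [a [b uE]]]]|].
    have /VE [|[[x' g'] [a' [b' []]]]] : exists k a b,
        u = `|block_entry G al xs (fun k => core_type D k.1 k.2) (fun k => P k.2) k a b|%N.
      by exists (x, g), a, b.
    by left.
    by rewrite negbK => /and3P[oD g3 _] ->; right; split=> //; exists (val g'), a', b'.
  case=> [ch|[oD [g [a [b [g3 uE]]]]]].
    by have [[x g] [a [b uE]]] := VE.2 (or_introl ch); exists x, g, a, b.
  have gka : (g < ka)%N by rewrite /ka; lia.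
  exists (- inZp g : 'I_D), (Ordinal gka), a, b.
  by rewrite /E /block_entry /G in_patchE oD g3 addNr eqxx.
- move=> g a b g' a' b'; rewrite !subr0 => /inZp_inj_small e -> ->; split=> //.
  by apply: val_inj; apply: e; apply: leq_trans le_kaD.
- move=> x a; rewrite -[RHS](row_sum x a); apply: eq_bigr => g _.
  by rewrite big_pred1_eq subr0.
- move=> z b; rewrite -[RHS](col_sum z b); apply: eq_bigr => g _.
  by rewrite big_pred1_eq.
Qed.

End Square.
End Core.

(** * Both line sizes congruent to 2 mod 4 *)

Lemma double_mod4 c n : (c * 2 * n) %% 4 = 2 -> odd c && odd n.
Proof. by rewrite mulnAC -oddM; move: (c * n) => x; lia. Qed.

(** Here [c = 2c'] and [d = 2d'] with [c'], [m'], [n'] odd. A core of [f] by [f] squares is cut off;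
    the strip to its right and the strip below it each have one line size divisible by 4. *)
Lemma zero_sum_array22 m n s k N al xs P :
  4 <= s <= n -> 4 <= k <= m -> m * s = n * k -> ~~ odd m -> ~~ odd n ->
  s %% 4 = 2 -> k %% 4 = 2 -> 4 * N = m * s ->
  size xs + 3 * odd N = N -> (odd N -> is_patch al P) ->
  zero_sum_array m n s k (fun u => chunks al xs u \/ (odd N /\ patch_values P u)).
Proof.
move=> /andP[s4 sn] /andP[k4 km] e em2 en2 s2 k2 eN sz HP.
have [d [c [m' [n' [[em en es ek le_cd] cop]]]]] :=
  gcd_parametrization (leq_trans (isT : 0 < 4) s4) (leq_trans (isT : 0 < 4) k4) sn e.
have /dvdnP[c' ec] : 2 %| c.
  have : 2 %| gcdn s k by rewrite dvdn_gcd; lia.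
  by rewrite es ek -muln_gcdr gcdnC (eqP cop) muln1.
have [oc on] : odd c' /\ odd n' by apply/andP/double_mod4; rewrite -ec -es.
have /andP[_ om] : odd c' && odd m' by apply: double_mod4; rewrite -ec -ek.
have /dvdnP[d' ed] : 2 %| d by move: em2; rewrite em oddM om andbT dvdn2.
(* The core needs at least three block diagonals: [f = 1] if [c'] is at least [3], otherwise
   [f = 3], which fits because [s] and [k] are at least [4] and [m'], [n'] are odd. *)
have [f [f0 of_ fm [fn fc]]] : exists f, [/\ 0 < f, odd f, f <= m' & f <= n' /\ 2 < f * c'].
  have [c3|c1] := leqP 3 c'; first by exists 1; split; lia.
  have e1 : c' = 1 by lia.
  have k' : k = 2 * m' by rewrite ek ec e1.
  have s' : s = 2 * n' by rewrite es ec e1.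
  by exists 3; rewrite e1; split=> //; [|split=> //]; lia.
have [r er] : exists r, f * c' = r.*2.+3.
  exists ((f * c' - 3) %/ 2); have : odd (f * c') by rewrite oddM of_ oc.
  by move: fc; move: (f * c') => x; lia.
have le_cd' : c' <= d' by lia.
have [D eD] : exists D, f * d' = D.+1.
  by exists (f * d').-1; rewrite prednK // muln_gt0 f0; lia.
have le_rD : r.*2.+3 <= D.+1 by rewrite -er -eD leq_mul2l le_cd' orbT.
have NE : N = d' * m' * n' * c'.
  by apply/eqP; rewrite -(eqn_pmul2l (isT : 0 < 4)) eN em es ec ed; apply/eqP; ring.
(* Both [N = d' m' n' c'] and the number [f d'] of block rows have the parity of [d']. *)
have oND : odd N = odd D.+1 by rewrite NE -eD !oddM om on oc of_ !andbT.
have [Nr eNr] : exists x, x = D.+1 * c' * (n' - f) by eexists.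
have [Nb eNb] : exists x, x = d' * (m' - f) * c' * n' by eexists.
have [C eC] : exists C, C = D.+1 * r.*2.+3 by eexists.
have [Nc eNc] : exists x, x = C - 3 * odd N by eexists.
have C3 : 3 <= C by rewrite eC; apply: leq_trans (leq_pmull _ (ltn0Sn D)).
have [[a ea] [b eb]] : (exists a, m' = f + a) /\ (exists b, n' = f + b).
  by split; [exists (m' - f)|exists (n' - f)]; rewrite subnKC.
have ma : m' - f = a by rewrite ea addKn.
have nb : n' - f = b by rewrite eb addKn.
have eNN : N = C + (Nr + Nb).
  by rewrite NE eC eNr eNb -er -eD ma nb ea eb; ring.
have szx : size xs = Nc + (Nr + Nb).
  by move: sz eNN C3 eNc; clear; move: (Nr + Nb) => y; case: (odd N); lia.
have szc : size (take Nc xs) + 3 * odd D.+1 = D.+1 * r.*2.+3.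
  rewrite -oND -eC size_takel ?szx ?leq_addr // eNc subnK //.
  by apply: leq_trans C3; case: (odd N).
have szr : size (take Nr (drop Nc xs)) = Nr.
  by rewrite size_takel // size_drop szx addKn leq_addr.
have szb : size (drop Nr (drop Nc xs)) = Nb.
  by rewrite !size_drop szx !addKn.
rewrite oND in HP.
have core := zero_sum_array_core le_rD szc HP.
have even_c : 2 %| c by rewrite ec dvdn_mull.
(* [n'] and [f] are both odd, so [n' - f] is even and [4] divides [c (n' - f)]; the bottom strip is
   treated alike. *)
have right_ : formal_array (D.+1 * 2) (d * (n' - f)) (c * (n' - f)) r.*2.+3.*2 Nr.
  have [nf0|nf1] := posnP (n' - f).
    by rewrite eNr nf0 !muln0; apply: formal_array_nocol.
  have c_gt0 : 0 < c by rewrite ec muln_gt0 odd_gt0.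
  apply/formal_array_tr/formal_array20; rewrite ?muln_gt0 ?nf1 ?c_gt0 //.
  - by rewrite -muln2 leq_mul2r le_rD.
  - by rewrite -(muln2 r.*2.+3) -er -eD ec ed; ring.
  - by clear; lia.
  - by rewrite -[4]/(2 * 2) dvdn_mul // dvdn2 oddB // on of_.
  - by rewrite eNr -(muln2 r.*2.+3) -er -eD ed; ring.
have bottom : formal_array (d * (m' - f)) n s (c * (m' - f)) Nb.
  have [mf0|mf1] := posnP (m' - f).
    by rewrite eNb mf0 !(muln0, mul0n); apply/formal_array_tr/formal_array_nocol.
  have c_gt0 : 0 < c by rewrite ec muln_gt0 odd_gt0.
  apply: formal_array20; rewrite ?muln_gt0 ?mf1 ?c_gt0 //.
  - by rewrite en es; ring.
  - by rewrite -[4]/(2 * 2) dvdn_mul // dvdn2 oddB // om of_.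
  - by rewrite eNb es ec ed; ring.
have top := zero_sum_array_catr core (right_ al _ szr).
move: top.
have -> : D.+1 * 2 + d * (n' - f) = n by rewrite nb en eb -eD ed; ring.
have -> : r.*2.+3.*2 + c * (n' - f) = s by rewrite nb es eb -(muln2 r.*2.+3) -er ec; ring.
move=> /zero_sum_array_tr top.
have := zero_sum_array_tr (zero_sum_array_catr top (zero_sum_array_tr (bottom al _ szb))).
have -> : D.+1 * 2 + d * (m' - f) = m by rewrite ma em ea -eD ed; ring.
have -> : r.*2.+3.*2 + c * (m' - f) = k by rewrite ma ek ea -(muln2 r.*2.+3) -er ec; ring.
apply: zero_sum_array_ext => u; rewrite oND.
have -> : chunks al xs u <-> chunks al (take Nc xs ++ take Nr (drop Nc xs) ++ drop Nr (drop Nc xs)) u.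
  by rewrite !cat_take_drop.
by rewrite !chunks_cat; tauto.
Qed.

(** * From arrays to Heffter arrays *)

Section Heffter.
Local Open Scope ring_scope.

Lemma line_ok_card n s (f : 'I_n -> option int) :
  line_ok s f -> #|[set j | isSome (f j)]| = s.
Proof.
case=> _ cnt; apply/eqP; rewrite -eqz_nat -cnt -sum1_card; apply/eqP.
rewrite -(natz (\sum_(_ in _) _)%N) natr_sum big_mkcond.
by apply: eq_bigr => j _; rewrite inE; case: (f j).
Qed.

Lemma val_natr_Zp v u : (1 < v)%N -> (u < v)%N -> (u%:R : 'Z_v) = u :> nat.
Proof. by move=> v1 uv; rewrite val_Zp_nat // modn_small. Qed.

Lemma signed_rep_intr v (z : int) : (1 < v)%N -> (`|z| * 2 < v)%N ->
  signed_rep (z%:~R : 'Z_v) = z.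
Proof.
move=> v1 zv; rewrite /signed_rep.
have [u [zE uv]] : exists u : nat, (z = u%:Z \/ z = - u%:Z) /\ (u * 2 < v)%N.
  by exists `|z|%N; split=> //; lia.
case: zE => -> {z zv}.
  rewrite -pmulrn val_natr_Zp; [|lia|lia].
  by rewrite ifT // leq_divRL; lia.
have [->|u0] := posnP u; first by rewrite oppr0.
have -> : ((- u%:Z)%:~R : 'Z_v) = (v - u)%N%:R.
  rewrite natrB; last by lia.
  by rewrite pchar_Zp // sub0r rmorphN /= -pmulrn.
rewrite val_natr_Zp; [|lia|lia].
rewrite ifF; last by apply/negbTE; rewrite -ltnNge ltn_divLR; lia.
by lia.
Qed.

Lemma cycle_of_order (v L t : nat) : (1 < v)%N -> v = (L * t)%N -> (0 < t)%N ->
  exists J : {group 'Z_v}, #|J| = t /\ forall x : 'Z_v, (L %| x)%N -> x \in J.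
Proof.
move=> v1 vE t0; have L0 : (0 < L)%N by lia.
exists <[(Zp1 : 'Z_v) ^+ L]>%G; split.
  rewrite [LHS]orderXdiv order_Zp1 Zp_cast // vE ?dvdn_mulr // mulKn //.
move=> x /dvdnP[y xE]; apply/cycleP; exists y.
by rewrite -expgM mulnC -xE Zp_expg -Zp_mulrn natr_Zp.
Qed.

Lemma integer_heffter_of_array (t m n s k L : nat) (V : nat -> Prop) :
  let v := heffter_order t m s in
  (1 < v)%N -> (0 < t)%N -> v = (L * t)%N -> (t %| 2 * m * s)%N ->
  (forall u, V u -> (2 * u < v)%N) ->
  (forall u, (0 < u)%N -> (2 * u < v)%N -> ~~ (L %| u)%N -> V u) ->
  zero_sum_array m n s k V -> exists_integer_heffter t m n s k.
Proof.
move=> v v1 t0 vE tdvd V1 V2 [M [Mr Mc M1 M2]].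
pose A : pf_array 'Z_v m n := \matrix_(i, j) omap (fun z : int => z%:~R) (M i j).
have Aid i j : oapp id 0 (A i j) = (oapp id 0 (M i j))%:~R.
  by rewrite mxE; case: (M i j).
have Asg i j : oapp signed_rep 0 (A i j) = oapp id 0 (M i j).
  rewrite mxE; case E: (M i j) => [z|] //=.
  by rewrite signed_rep_intr //; have := V1 _ (M1 _ _ _ E); lia.
have Asome i j : isSome (A i j) = isSome (M i j) by rewrite mxE; case: (M i j).
exists A; split; last first.
  split=> [i|j]; [rewrite -[RHS](Mr i).1|rewrite -[RHS](Mc j).1];
    by apply: eq_bigr => l _; rewrite Asg.
have [J [cardJ memJ]] := cycle_of_order v1 vE t0.
exists J; split=> //.
- split=> [i|j].
    apply: etrans (line_ok_card (Mr i)); apply: eq_card => j.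
    by rewrite !inE Asome.
  apply: etrans (line_ok_card (Mc j)); apply: eq_card => i.
  by rewrite !inE Asome.
- move=> x xJ; have nLx : ~~ (L %| x)%N by apply: contra xJ => /memJ.
  have xv : (x < v)%N by rewrite -[X in (_ < X)%N](Zp_cast v1).
  have x0 : (0 < x)%N by rewrite lt0n; apply: contra nLx => /eqP ->; rewrite dvdn0.
  have app (z : int) (y : 'Z_v) : V `|z|%N -> z%:~R = y \/ z%:~R = - y ->
      appears A y \/ appears A (- y).
    move=> /M2[i [j [w [Mij zw]]]] zy.
    have {zy} [wy|wy] : w%:~R = y \/ w%:~R = - y :> 'Z_v.
      have [->|->] : w = z \/ w = - z by lia.
        by [].
      by rewrite mulrNz; case: zy => ->; rewrite ?opprK; [right|left].
    + by left; exists i, j; rewrite mxE Mij /= wy.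
    + by right; exists i, j; rewrite mxE Mij /= wy.
  have [lt|ge] := ltnP (2 * x)%N v.
    apply: (app (x : nat)%:Z); first exact: V2.
    by left; rewrite -pmulrn natr_Zp.
  (* If [x = v/2], then [v] and hence [t] are even, and [x = L (t/2)] would be a multiple of [L]. *)
  have ne : (2 * x)%N <> v.
    move=> e; case/negP: nLx.
    have /dvdnP[h th] : (2 %| t)%N.
      have : (2 %| v)%N by rewrite -e dvdn_mulr.
      by rewrite /v /heffter_order -mulnA dvdn_addr // dvdn_mulr.
    by apply/dvdnP; exists h; nia.
  apply: (app (v - x)%N%:Z).
    apply: V2; [lia|lia|].
    by rewrite absz_nat dvdn_subr ?(ltnW xv) // vE dvdn_mulr.
  by right; rewrite -pmulrn natrB ?(ltnW xv) // pchar_Zp // sub0r natr_Zp.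
- split=> [i|j].
    by under eq_bigr do rewrite Aid; rewrite -rmorph_sum /= (Mr i).1.
  by under eq_bigr do rewrite Aid; rewrite -rmorph_sum /= (Mc j).1.
Qed.

End Heffter.

(** * Splitting the set of absolute values into chunks *)

Section Supply.
Local Open Scope ring_scope.

Definition support (t L u : nat) : Prop :=
  [/\ 0 < u, 2 * u < t * L & ~~ (L %| u)]%N.

Lemma chunks_iota al (x : nat -> int) N u :
  chunks al [seq x j | j <- iota 0 N] u <->
  exists j r, [/\ (j < N)%N, (r < 4)%N & u = `|(x j + al * r%:Z)%R|%N].
Proof.
split=> [[y /mapP[j]]|[j [r [jN r4 ->]]]].
  by rewrite mem_iota add0n => jN -> [r [r4 ->]]; exists j, r.
by exists (x j); [apply: map_f; rewrite mem_iota|exists r].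
Qed.

Lemma support_cover t L u : (0 < L)%N ->
  support t L.+1 u <->
  exists a w, [/\ u = a * L.+1 + w, 0 < w, w <= L & 2 * (a * L.+1 + w) < t * L.+1]%N.
Proof.
move=> L0; split=> [[u0 uv nd]|[a [w [-> w0 wL uv]]]].
  exists (u %/ L.+1)%N, (u %% L.+1)%N; rewrite -divn_eq; split=> //.
    by rewrite lt0n.
  by rewrite -ltnS ltn_mod.
split=> //; first by rewrite addn_gt0 w0 orbT.
by rewrite dvdn_addr ?dvdn_mull // gtnNdvd.
Qed.

(* [j %/ p] multiples of [L = 4p+1] are skipped before the [j]-th chunk. *)
Lemma support_chunks_unit t p N u : (0 < p)%N -> (2 * N = t * p)%N ->
  support t (4 * p).+1 u <->
  chunks 1 [seq (1 + 4 * j + j %/ p)%N%:Z | j <- iota 0 N] u.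
Proof.
move=> p0 eN; rewrite support_cover ?chunks_iota; last by lia.
split=> [[a [w [-> w0 wL uv]]]|[j [r [jN r4 ->]]]].
  have ea : (2 * a < t)%N by nia.
  pose b := ((w - 1) %/ 4)%N.
  have bp : (b < p)%N by rewrite /b; lia.
  exists (a * p + b)%N, ((w - 1) %% 4)%N; split; last 2 first.
  - by rewrite ltn_mod.
  - rewrite divnMDl // (divn_small bp).
    have := divn_eq (w - 1) 4; rewrite -/b => e; nia.
  (* Either the whole gap after [aL] lies below [tL/2], or [t = 2a + 1] and only its first half
     does. In that case [p] is even, and the half gap consists of [p/2] whole chunks. *)
  have [le2|gt2] := leqP (2 * a + 2) t; first by nia.
  have et : t = (2 * a + 1)%N by lia.
  by rewrite et in eN uv; rewrite /b in bp *; nia.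
have := divn_eq j p; set a := (j %/ p)%N; set b := (j %% p)%N => ej.
have bp : (b < p)%N by rewrite ltn_mod.
exists a, (4 * b + r + 1)%N; split; [nia|lia|lia|].
have ea : (2 * a < t)%N by nia.
have [le2|gt2] := leqP (2 * a + 2) t; first by nia.
have et : t = (2 * a + 1)%N by lia.
by rewrite et in eN *; nia.
Qed.

Lemma mixed_radix_lt i la w tau : (i < tau -> w < la -> i * la + w < la * tau)%N.
Proof.
move=> it wl; rewrite (mulnC la); apply: (@leq_trans (i.+1 * la)).
  by rewrite mulSn addnC ltn_add2r.
by rewrite leq_mul2r it orbT.
Qed.

(** The bound [v/2] equals [4 tau L], so each nonzero residue mod [L] is represented by [4 tau]
    values, that is by [tau] chunks of difference [L]. *)
Lemma support_chunks_odd tau l N u : (0 < l)%N -> N = (l * tau)%N ->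
  support (8 * tau) l.+1 u <->
  chunks l.+1%:Z [seq (1 + j %% l + 4 * l.+1 * (j %/ l))%N%:Z | j <- iota 0 N] u.
Proof.
move=> l0 eN; rewrite support_cover ?chunks_iota //.
split=> [[a [w [-> w0 wL uv]]]|[j [r [jN r4 ->]]]].
  have ea : (a < 4 * tau)%N by nia.
  have := divn_eq a 4; set i := (a %/ 4)%N; set r := (a %% 4)%N => e.
  have r4 : (r < 4)%N by rewrite ltn_mod.
  case: w w0 wL uv => // w _ wl _.
  exists (i * l + w)%N, r; split=> //; first by rewrite eN mixed_radix_lt //; lia.
  by rewrite divnMDl // modnMDl (divn_small wl) (modn_small wl) e; lia.
have bp : (j %% l < l)%N by rewrite ltn_mod.
have ip : (j %/ l < tau)%N by rewrite ltn_divLR // mulnC -eN.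
move: bp ip; set b := (j %% l)%N; set i := (j %/ l)%N => bp ip.
exists (4 * i + r)%N, b.+1; split=> //; first by lia.
have : ((4 * i + r).+1 * l.+1 <= 4 * tau * l.+1)%N by rewrite leq_mul2r; lia.
by clear -bp; lia.
Qed.

(* The residues [w] and [L - w] mod [L] are merged into one progression of
   difference [L], running through negative numbers. *)
Lemma support_chunks_signed tau la N u : (0 < la)%N -> N = (la * tau)%N ->
  support (4 * tau) (2 * la).+1 u <->
  chunks (2 * la).+1%:Z
    [seq (1 + j %% la + 4 * (2 * la).+1 * (j %/ la))%N%:Z - (2 * tau * (2 * la).+1)%N%:Z
       | j <- iota 0 N] u.
Proof.
move=> l0 eN; rewrite support_cover ?chunks_iota; last by lia.
split=> [[a [w [-> w0 wL uv]]]|[j [r [jN r4 ->]]]].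
  have ea : (a < 2 * tau)%N by nia.
  have [wla|wla] := leqP w la.
    have := divn_eq (2 * tau + a) 4.
    set i := ((_ + a) %/ 4)%N; set r := ((_ + a) %% 4)%N => e.
    have r4 : (r < 4)%N by rewrite ltn_mod.
    case: w w0 wL uv wla => // w _ _ _ wla.
    exists (i * la + w)%N, r; split=> //; first by rewrite eN mixed_radix_lt //; lia.
    rewrite divnMDl // modnMDl (divn_small wla) (modn_small wla).
    have -> : (a = i * 4 + r - 2 * tau)%N by lia.
    have le : (2 * tau * (2 * la).+1 <= (i * 4 + r) * (2 * la).+1)%N.
      by rewrite leq_mul2r; lia.
    by rewrite mulnBl; clear -le; lia.
  (* For [w > la] the value [aL + w] is the absolute value of [(L - w) - (a+1)L], the term number
     [2 tau - (a+1)] in the progression of the residue [L - w]. *)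
  have := divn_eq (2 * tau - a.+1) 4.
  set i := ((_ - _) %/ 4)%N; set r := ((_ - _) %% 4)%N => e.
  have r4 : (r < 4)%N by rewrite ltn_mod.
  have [b eb] : exists b, (2 * la = w + b)%N by exists (2 * la - w)%N; lia.
  have bla : (b < la)%N by lia.
  exists (i * la + b)%N, r; split=> //; first by rewrite eN mixed_radix_lt //; lia.
  rewrite divnMDl // modnMDl (divn_small bla) (modn_small bla).
  have -> : (2 * tau = a + (i * 4 + r).+1)%N by lia.
  have -> : (w = 2 * la - b)%N by lia.
  by clear -bla; lia.
have bp : (j %% la < la)%N by rewrite ltn_mod.
have ip : (j %/ la < tau)%N by rewrite ltn_divLR // mulnC -eN.
move: bp ip; set b := (j %% la)%N; set i := (j %/ la)%N => bp ip.
have [ge|lt] := leqP (2 * tau) (4 * i + r).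
  have [a ea] : exists a, (4 * i + r = 2 * tau + a)%N by exists (4 * i + r - 2 * tau)%N; lia.
  have le : (a.+1 * (2 * la).+1 <= 2 * tau * (2 * la).+1)%N by rewrite leq_mul2r; lia.
  exists a, b.+1; split=> //; [|by lia|].
    have -> : (r = 2 * tau + a - 4 * i)%N by lia.
    have le' : (4 * i * (2 * la).+1 <= (2 * tau + a) * (2 * la).+1)%N by rewrite leq_mul2r; lia.
    by clear -le' ea; lia.
  by clear -le bp; lia.
have [a ea] : exists a, (2 * tau = a + (4 * i + r).+1)%N.
  by exists (2 * tau - (4 * i + r).+1)%N; lia.
have le : (a.+1 * (2 * la).+1 <= 2 * tau * (2 * la).+1)%N by rewrite leq_mul2r; lia.
exists a, (2 * la - b)%N; split=> //; [|by lia|by lia|].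
  by rewrite ea; clear -bp; lia.
by clear -le bp; lia.
Qed.

Lemma odd_gap_param t l N : odd l -> (8 * N = t * l)%N ->
  exists2 tau, t = (8 * tau)%N & N = (l * tau)%N.
Proof.
move=> ol eN.
have /dvdnP[tau et] : (8 %| t)%N.
  by rewrite -(@Gauss_dvdl 8 t l) -?eN ?dvdn_mulr // (@coprimeXl 3 2) // coprime2n.
by exists tau; move: eN; rewrite et; lia.
Qed.

Lemma half_odd_gap_param t l N : (l %% 4 = 2)%N -> (8 * N = t * l)%N ->
  exists la tau, [/\ odd la, l = 2 * la, t = 4 * tau & N = la * tau]%N.
Proof.
move=> l2 eN; pose la := (l %/ 2)%N.
have el : l = (2 * la)%N by rewrite /la; lia.
have ola : odd la by rewrite /la; lia.
have eN4 : (4 * N = t * la)%N by move: eN; rewrite el; lia.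
have /dvdnP[tau et] : (4 %| t)%N.
  by rewrite -(@Gauss_dvdl 4 t la) -?eN4 ?dvdn_mulr // (@coprimeXl 2 2) // coprime2n.
by exists la, tau; move: eN4; rewrite et; split=> //; lia.
Qed.

End Supply.

(** * Patches *)

Section Patches.
Local Open Scope ring_scope.

Definition patch_of (w : seq int) (g : nat) (a b : bool) : int :=
  nth 0 w (4 * g + 2 * a + b).

Lemma patch_values_of w u : size w = 12%N ->
  patch_values (patch_of w) u <-> u \in [seq `|z|%N | z <- w].
Proof.
move=> sz; split=> [[g [a [b [g3 ->]]]]|/mapP[z /(nthP 0)[i]]].
  by apply/map_f/mem_nth; rewrite sz; case: a; case: b; lia.
rewrite sz => i12 <- ->; exists (i %/ 4)%N, (odd (i %/ 2)), (odd i); split; first by lia.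
by rewrite /patch_of; congr `|nth _ _ _|%N; lia.
Qed.

Lemma chunksE al xs u :
  chunks al xs u <-> u \in [seq `|z|%N | z <- flatten [seq [:: x + al * 0; x + al * 1; x + al * 2; x + al * 3] | x <- xs]].
Proof.
split=> [[x xin [r [r4 ->]]]|/mapP[z /flatten_mapP[x xin]]].
  apply/map_f/flatten_mapP; exists x => //; rewrite !inE.
  by case: r r4 => [|[|[|[|]]]] // _; rewrite eqxx ?orbT.
rewrite !inE => /or4P[]/eqP -> ->; exists x => //.
- by exists 0%N.
- by exists 1%N.
- by exists 2%N.
- by exists 3%N.
Qed.

Lemma is_patch_of al w : size w = 12%N ->
  [/\ w`_0 + w`_1 = 3 * al, w`_2 + w`_3 = - al, w`_4 + w`_5 = - al & w`_6 + w`_7 = - al] ->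
  w`_8 + w`_9 = - (2 * al) /\ w`_10 + w`_11 = 2 * al ->
  w`_0 + w`_2 + w`_4 + w`_6 + w`_8 + w`_10 = 0 ->
  is_patch al (patch_of w).
Proof.
move=> sz [r0 r1 r2 r3] [r4 r5] c0; split=> [g a g3|b].
  rewrite big_bool /patch_of; case: g g3 => [|[|[|]]] // _; case: a => /=; rewrite addrC.
  - by rewrite r1; ring.
  - by rewrite r0; ring.
  - by rewrite r3; ring.
  - by rewrite r2; ring.
  - by rewrite r5; ring.
  - by rewrite r4; ring.
(* The six row sums add up to zero, so the second column sum is minus the first. *)
have c1 : w`_1 + w`_3 + w`_5 + w`_7 + w`_9 + w`_11 = 0.
  by move: r0 r1 r2 r3 r4 r5 c0; clear; lia.
rewrite !big_ord_recl big_ord0 !big_bool /patch_of /=; case: b => /=; last first.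
  by rewrite -[RHS]c0; ring.
by rewrite -[RHS]c1; ring.
Qed.

Lemma patch_of_chunks al x0 x1 x2 w u : size w = 12%N ->
  perm_eq [seq `|z|%N | z <- w] [seq `|z|%N | z <- flatten
    [seq [:: x + al * 0; x + al * 1; x + al * 2; x + al * 3] | x <- [:: x0; x1; x2]]] ->
  patch_values (patch_of w) u <-> chunks al [:: x0; x1; x2] u.
Proof. by move=> sz pe; rewrite patch_values_of // chunksE (perm_mem pe). Qed.

Lemma remove_three al (x : nat -> int) N j0 j1 j2 :
  uniq [:: j0; j1; j2] -> all (fun j => j < N)%N [:: j0; j1; j2] ->
  exists xs, (size xs + 3 = N)%N /\ forall u,
    chunks al [seq x j | j <- iota 0 N] u <->
    chunks al xs u \/ chunks al [:: x j0; x j1; x j2] u.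
Proof.
set js := [:: j0; j1; j2] => ujs ltN.
pose rest := filter [predC mem js] (iota 0 N).
have pjs : perm_eq (filter (mem js) (iota 0 N)) js.
  apply: uniq_perm => //; first by rewrite filter_uniq ?iota_uniq.
  move=> j; rewrite mem_filter mem_iota /=.
  by case: (boolP (j \in js)) => //= /(allP ltN) ->.
have pe : perm_eq (iota 0 N) (rest ++ js).
  rewrite perm_sym perm_catC; apply: perm_trans (_ : perm_eq (filter (mem js) (iota 0 N) ++ rest) _).
    by rewrite perm_cat2r perm_sym.
  by rewrite perm_filterC.
exists [seq x j | j <- rest]; split.
  by have := perm_size pe; rewrite size_iota size_cat size_map.
move=> u; have e := perm_mem (perm_map x pe).
by rewrite (eq_mem_chunks al u e) map_cat chunks_cat.
Qed.

Definition patched_supply (t l N : nat) : Prop :=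
  exists (al : int) (xs : seq int) (P : nat -> bool -> bool -> int),
    [/\ (size xs + 3 = N)%N, is_patch al P &
        forall u, support t l.+1 u <-> chunks al xs u \/ patch_values P u].

Lemma patched_supply_chunks t l N al (x : nat -> int) j0 j1 j2 w :
  (forall u, support t l.+1 u <-> chunks al [seq x j | j <- iota 0 N] u) ->
  uniq [:: j0; j1; j2] -> all (fun j => j < N)%N [:: j0; j1; j2] ->
  size w = 12%N -> is_patch al (patch_of w) ->
  perm_eq [seq `|z|%N | z <- w] [seq `|z|%N | z <- flatten
    [seq [:: y + al * 0; y + al * 1; y + al * 2; y + al * 3] | y <- [:: x j0; x j1; x j2]]] ->
  patched_supply t l N.
Proof.
move=> supp ujs ltN sz Pw pe; have [xs [szxs ch]] := remove_three al x ujs ltN.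
exists al, xs, (patch_of w); split=> // u.
by rewrite supp ch (patch_of_chunks u sz pe).
Qed.

(* Twelve consecutive terms [y, y+al, ..., y+11al] admit the patch with rows (in
   units of [al], relative to [y])
   [-0 +3], [+1 -2], [+4 -5], [+10 -11], [-8 +6], [-7 +9]. *)
Lemma patched_supply_AP t l N al (x : nat -> int) j0 j1 j2 :
  (forall u, support t l.+1 u <-> chunks al [seq x j | j <- iota 0 N] u) ->
  uniq [:: j0; j1; j2] -> all (fun j => j < N)%N [:: j0; j1; j2] ->
  x j1 = x j0 + 4 * al -> x j2 = x j0 + 8 * al ->
  patched_supply t l N.
Proof.
move=> supp ujs ltN e1 e2.
pose e j (r : int) := x j + al * r.
apply: (@patched_supply_chunks _ _ _ _ _ _ _ _
  [:: - e j0 0; e j0 3; e j0 1; - e j0 2;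
      e j1 0; - e j1 1; e j2 2; - e j2 3;
      - e j2 0; e j1 2; - e j1 3; e j2 1] supp ujs ltN) => //.
  by apply: is_patch_of => //=; rewrite /e e1 e2; split || idtac; try split; ring.
by apply/seq.permP => p; rewrite /= !abszN /e; ring.
Qed.

(* Here the block [[1, 2], [3, -4]] replaces one of type [TU]. *)
Lemma patched_supply1 t p N : (0 < p)%N -> (2 * N = t * p)%N -> (3 <= N)%N ->
  patched_supply t (4 * p) N.
Proof.
move=> p0 eN N3.
have [x xE] : exists x, x = fun j => (1 + 4 * j + j %/ p)%N%:Z by eexists.
pose e j (r : int) := x j + 1 * r.
apply: (@patched_supply_chunks _ _ _ 1 x 0 1 2
  [:: e 0%N 0; e 0%N 1; e 0%N 2; - e 0%N 3;
      e 1%N 0; - e 1%N 1; - e 1%N 3; e 1%N 2;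
      e 2%N 0; - e 2%N 2; - e 2%N 1; e 2%N 3]) => //.
- by move=> u; rewrite xE; apply: support_chunks_unit.
- by rewrite /= !andbT; lia.
(* The value [1] matters: the first row of the patch has two entries of equal sign, and [2 x0 + 1]
   has to equal [3]. *)
- have x0 : x 0%N = 1 by rewrite xE div0n.
  by apply: is_patch_of => //=; rewrite /e ?x0; try split; ring.
by apply/seq.permP => q; rewrite /= !abszN /e; ring.
Qed.

Lemma patched_supply2 t l N : odd l -> (8 * N = t * l)%N -> (9 <= N)%N -> odd N ->
  patched_supply t l N.
Proof.
move=> ol eN N9 oN.
have [tau et eN'] := odd_gap_param ol eN; subst t.
have l0 : (0 < l)%N by lia.
have [x xE] : exists x, x = fun j => (1 + j %% l + 4 * l.+1 * (j %/ l))%N%:Z by eexists.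
have supp u : support (8 * tau) l.+1 u <-> chunks l.+1%:Z [seq x j | j <- iota 0 N] u.
  by rewrite xE; apply: support_chunks_odd.
have otau : odd tau by move: oN; rewrite eN' oddM => /andP[].
(* Chunks whose indices differ by [l] follow each other in the progression of one residue, so [0],
   [l], [2l] give twelve consecutive terms. *)
have [tau3|tau1] := leqP 3 tau.
  apply: (@patched_supply_AP _ _ _ _ _ 0 l (2 * l) supp).
  - by rewrite /= !inE; lia.
  - by rewrite /= !andbT eN'; nia.
  - by rewrite xE modnn divnn l0 mod0n div0n; lia.
  - by rewrite xE modnMl mulnK // mod0n div0n; lia.
(* For [t = 8] no twelve consecutive terms exist; the patch combines the chunk
   [L/2 * {1, 3, 5, 7}] with the eight terms [1-4L, 1-3L, ..., 1+3L]. *)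
have e1 : tau = 1%N by lia.
have elN : l = N by rewrite eN' e1 muln1.
pose h := (l %/ 2)%N; have eh : l = (2 * h).+1 by rewrite /h; lia.
have xs j : (j < l)%N -> x j = j.+1%:Z.
  by move=> jl; rewrite xE (divn_small jl) (modn_small jl); lia.
pose e j (r : int) := x j + l.+1%:Z * r.
apply: (@patched_supply_chunks _ _ _ l.+1%:Z x h 0 l.-1
  [:: - e h 0; e h 3; e h 1; - e h 2;
      - e l.-1 3; e l.-1 2; e 0%N 2; - e 0%N 3;
      - e 0%N 0; - e l.-1 1; e l.-1 0; e 0%N 1]) => //.
- by rewrite /= !inE; lia.
- by rewrite /= !andbT; lia.
- have [x0 xh xl] : [/\ x 0%N = 1, x h = h.+1%:Z & x l.-1 = (2 * h).+1%:Z].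
    by split; rewrite xs; lia.
  rewrite /e x0 xh xl.
  by apply: is_patch_of => //=; rewrite eh; try split; lia.
by apply/seq.permP => q; rewrite /= !abszN /e; ring.
Qed.

Lemma patched_supply3 t l N : (l %% 4 = 2)%N -> (8 * N = t * l)%N -> (9 <= N)%N -> odd N ->
  patched_supply t l N.
Proof.
move=> l2 eN N9 oN.
have [la [tau [ola el et eN']]] := half_odd_gap_param l2 eN; subst t.
have la0 : (0 < la)%N by rewrite odd_gt0.
have otau : odd tau by move: oN; rewrite eN' oddM => /andP[].
rewrite el.
have [tau3|tau1] := leqP 3 tau.
  pose x j := (1 + j %% la + 4 * (2 * la).+1 * (j %/ la))%N%:Z - (2 * tau * (2 * la).+1)%N%:Z.
  have supp u : support (4 * tau) (2 * la).+1 u <->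
      chunks (2 * la).+1%:Z [seq x j | j <- iota 0 N] u.
    exact: support_chunks_signed.
  apply: (@patched_supply_AP _ _ _ _ _ 0 la (2 * la) supp).
  - by rewrite /= !inE; lia.
  - by rewrite /= !andbT eN'; nia.
  - by rewrite /x modnn divnn la0 mod0n div0n; lia.
  - by rewrite /x modnMl mulnK // mod0n div0n; lia.
(* For [t = 4] the patch is a window of twelve numbers around the missing
   multiple [L = 2N+1]. *)
have e1 : tau = 1%N by lia.
have elN : la = N by rewrite eN' e1 muln1.
rewrite e1 elN muln1.
(* As [N] is odd, the [2N - 6 = 4M] numbers on either side of the window split into [M] runs of four
   consecutive numbers; the common difference is now [1]. *)
pose M := ((N - 3) %/ 2)%N; have eM : N = (2 * M + 3)%N by rewrite /M; lia.
pose x j := (if j < M then 1 + 4 * j else 2 * N + 8 + 4 * (j - M))%N%:Z.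
have [Z eZ] : exists Z, Z = (2 * N - 5)%N by eexists.
pose z := Z%:Z.
pose w : seq int := [:: - (z + 1); z + 4; z + 7; - (z + 8);
  z + 9; - (z + 10); - (z + 12); z + 11;
  z + 0; - (z + 2); - (z + 3); z + 5].
exists 1, [seq x j | j <- iota 0 (N - 3)], (patch_of w); split.
- by rewrite size_map size_iota; lia.
- by apply: is_patch_of => //=; try split; ring.
move=> u; rewrite chunks_iota patch_values_of // support_cover; last by lia.
have wE : (u \in [seq `|i|%N | i <- w]) = ((2 * N - 5 <= u <= 2 * N + 7) && (u != 2 * N + 1))%N.
  have -> : [seq `|i|%N | i <- w] =
      [seq (Z + i)%N | i <- [:: 1; 4; 7; 8; 9; 10; 12; 11; 0; 2; 3; 5]%N].
    by rewrite /w /= !abszN.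
  have [leZ|ltZ] := leqP Z u; last first.
    transitivity false; last by clear -eZ ltZ; lia.
    by apply/mapP => -[i _ ui]; move: ltZ; rewrite ui ltnNge leq_addr.
  have [i ui] : exists i, u = (Z + i)%N by exists (u - Z)%N; rewrite subnKC.
  rewrite ui mem_map; last exact: addnI.
  transitivity ((i <= 12) && (i != 6))%N; last by clear -eZ eM; lia.
  by clear; do 13!case: i => [//|i].
rewrite wE; split=> [[a [y [-> y0 yL uv]]]|].
  have a1 : (a < 2)%N by nia.
  have [->|->] : (a = 0 \/ a = 1)%N by lia.
    rewrite mul0n add0n; have [lt|ge] := leqP y (2 * N - 6); last by right; lia.
    left; exists ((y - 1) %/ 4)%N, ((y - 1) %% 4)%N; split; [lia|lia|].
    by rewrite /x ifT; lia.
  rewrite mul1n; have [lt|ge] := leqP y 6; first by right; lia.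
  left; exists (M + (y - 7) %/ 4)%N, ((y - 7) %% 4)%N; split; [lia|lia|].
  by rewrite /x ifF; lia.
case=> [[j [r [jN r4 ->]]]|]; last first.
  move=> /andP[/andP[u1 u2] u3].
  have [lt|ge] := leqP u (2 * N); first by exists 0%N, u; split; lia.
  by exists 1%N, (u - (2 * N).+1)%N; split; lia.
rewrite /x; case: ifP => jM.
  by exists 0%N, (1 + 4 * j + r)%N; split; lia.
by exists 1%N, (7 + 4 * (j - M) + r)%N; split; lia.
Qed.

End Patches.

(** * Supplies for every divisor [t], and the existence theorem *)

Lemma chunk_supply t l N : 0 < N -> 8 * N = t * l ->
  exists (al : int) (xs : seq int),
    size xs = N /\ forall u, support t l.+1 u <-> chunks al xs u.
Proof.
move=> N0 eN; have l0 : 0 < l by case: l eN => //; rewrite muln0; lia.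
(* Since [8N = t l], the part of the factor [8] missing from [l] divides [t]: difference [1] works
   if [4] divides [l]; otherwise [t] is divisible by [8] or by [4], and the difference is [L]. *)
have [/dvdnP[p el]|n4] := boolP (4 %| l); last have [ol|el2] := boolP (odd l).
- have eN' : 2 * N = t * p by move: eN; rewrite el; lia.
  have p0 : 0 < p by lia.
  exists 1%R; eexists; split; last by move=> u; rewrite el mulnC; apply: support_chunks_unit p0 eN'.
  by rewrite size_map size_iota.
- have [tau et eN'] := odd_gap_param ol eN; subst t.
  exists l.+1%:Z%R; eexists; split; last by move=> u; apply: support_chunks_odd l0 eN'.
  by rewrite size_map size_iota.
- have l2 : l %% 4 = 2 by lia.
  have [la [tau [ola el et eN']]] := half_odd_gap_param l2 eN; subst t.
  exists (2 * la).+1%:Z%R; eexists; split; last first.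
    by move=> u; rewrite el; apply: support_chunks_signed (odd_gt0 ola) eN'.
  by rewrite size_map size_iota.
Qed.

Lemma patched_chunk_supply t l N : 9 <= N -> odd N -> 8 * N = t * l ->
  patched_supply t l N.
Proof.
move=> N9 oN eN.
have [/dvdnP[p el]|n4] := boolP (4 %| l).
  rewrite el mulnC; apply: patched_supply1; [|by move: eN; rewrite el; lia|by lia].
  by case: p el => // el; move: eN; rewrite el muln0; lia.
have [ol|el] := boolP (odd l); first exact: patched_supply2.
by apply: patched_supply3 => //; lia.
Qed.

(** From [2ms = t l] one gets [v = t (l + 1)], so [L = l + 1] and the multiples of [L] form the
    subgroup of order [t]. *)
Lemma integer_heffter_of_supply t l m n s k N V :
  0 < N -> 4 * N = m * s -> 2 * m * s = t * l ->
  (forall u, support t l.+1 u <-> V u) -> zero_sum_array m n s k V ->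
  exists_integer_heffter t m n s k.
Proof.
move=> N0 eN et supp arr.
have t0 : 0 < t by case: t et {supp} => //; rewrite mul0n -mulnA -eN; lia.
have vE : heffter_order t m s = l.+1 * t.
  by rewrite /heffter_order et mulSn mulnC addnC.
have vE' : t * l.+1 = heffter_order t m s by rewrite vE mulnC.
apply: (@integer_heffter_of_array t m n s k l.+1 V) => //.
- by rewrite /heffter_order -mulnA -eN; lia.
- by rewrite et dvdn_mulr.
- by move=> u /supp[_]; rewrite vE'.
- by move=> u u0 uv nd; apply/supp; split=> //; rewrite vE'.
Qed.

Lemma integer_heffter_of_formal t m n s k N :
  0 < N -> 4 * N = m * s -> t %| 2 * m * s -> formal_array m n s k N ->
  exists_integer_heffter t m n s k.
Proof.
move=> N0 eN /dvdnP[l]; rewrite mulnC [l * t]mulnC => et arr.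
have et' : 2 * m * s = t * l by rewrite -et; lia.
have [|al [xs [sz supp]]] := @chunk_supply t l N N0; first by rewrite -et'; lia.
exact: integer_heffter_of_supply N0 eN et' supp (arr al xs sz).
Qed.

Theorem theorem1p3 (m n s k t : nat)
    (hs : 4 <= s <= n) (hk : 4 <= k <= m) (hmn : m * s = n * k)
    (ht : t %| 2 * m * s) :
  [/\ (s = 0 %[mod 4] -> k = 0 %[mod 4] -> exists_integer_heffter t m n s k),
      (s = 2 %[mod 4] -> k = 0 %[mod 4] ->
         (exists_integer_heffter t m n s k <-> ~~ odd m)),
      (s = 0 %[mod 4] -> k = 2 %[mod 4] ->
         (exists_integer_heffter t m n s k <-> ~~ odd n)) &
      (~~ odd m -> ~~ odd n -> s = 2 %[mod 4] -> k = 2 %[mod 4] ->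
         exists_integer_heffter t m n s k)].
Proof.
have /andP[s4 sn] := hs; have /andP[k4 km] := hk.
have [s0 k0] : 0 < s /\ 0 < k by lia.
have ms0 : 0 < m * s by rewrite muln_gt0 s0 andbT; lia.
rewrite -[0 %% 4]/0 -[2 %% 4]/2.
have quarter : 4 %| m * s -> exists2 N, 0 < N & 4 * N = m * s.
  by case/dvdnP=> N eN; exists N; lia.
split.
- move=> /eqP s_0 /eqP k_0.
  have [|N N0 eN] := quarter; first by rewrite dvdn_mull.
  by apply: (integer_heffter_of_formal N0 eN ht); apply: formal_array00.
- move=> s_2 /eqP k_0.
  have ms4 : 4 %| m * s by rewrite hmn dvdn_mull.
  (* The only-if direction is pure arithmetic: [4] divides [nk = ms] while [s] is [2] mod [4], which
     forces [m] to be even. *)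
  have em : ~~ odd m.
    by apply: contraL ms4 => om; rewrite Gauss_dvdr ?(@coprimeXl 2 2) ?coprime2n //; lia.
  have [|N N0 eN] := quarter; first by [].
  split=> // _; apply: (integer_heffter_of_formal N0 eN ht).
  exact: formal_array20.
- move=> /eqP s_0 k_2.
  have ms4 : 4 %| m * s by rewrite dvdn_mull.
  have en : ~~ odd n.
    by apply: contraL ms4 => on; rewrite hmn Gauss_dvdr ?(@coprimeXl 2 2) ?coprime2n //; lia.
  have [|N N0 eN] := quarter; first by [].
  split=> // _; apply: (integer_heffter_of_formal N0 eN ht).
  by apply: formal_array_tr; apply: formal_array20; rewrite // -hmn.
- move=> em en s_2 k_2.
  have [|N N0 eN] := quarter; first by rewrite -[4]/(2 * 2) dvdn_mul ?dvdn2 //; lia.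
  (* Being [2] mod [4] and at least [4], both [s] and [k] are at least [6], hence [4N = ms] is at
     least [36]. *)
  have N9 : 9 <= N by nia.
  have /dvdnP[l el] := ht; have et : 2 * m * s = t * l by rewrite el mulnC.
  have e8 : 8 * N = t * l by rewrite -et; lia.
  have [oN|eN2] := boolP (odd N).
    have [al [xs [P [sz HP supp]]]] := patched_chunk_supply N9 oN e8.
    have arr := zero_sum_array22 hs hk hmn em en s_2 k_2 eN.
    apply: (@integer_heffter_of_supply t l m n s k N _ N0 eN et _ (arr al xs P _ _)).
    + by move=> u; rewrite supp oN; split=> [[]|[|[]]]; auto.
    + by rewrite oN.
    + by [].
  have [al [xs [sz supp]]] := chunk_supply N0 e8.
  have arr := zero_sum_array22 hs hk hmn em en s_2 k_2 eN.
  (* For even [N] the core contains no patch; the zero function is a placeholder. *)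
  apply: (@integer_heffter_of_supply t l m n s k N _ N0 eN et _
    (arr al xs (fun _ _ _ => 0%R) _ _)).
  + move=> u; rewrite supp (negPf eN2); split; [by left|by case=> // -[]].
  + by rewrite (negPf eN2) addn0.
  + by rewrite (negPf eN2).
Qed.
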